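(* Let $\mathcal{G}=(\mathcal{V},\mathcal{E},A)$ be a weighted digraph on $n$ nodes that contains a directed spanning tree, with graph Laplacian $L$. Let $\Delta>0$, let $\mathtt{q}^s(z)=\left\lfloor \frac{z}{\Delta}+\frac12\right\rfloor\Delta$ for $z\in\mathbb{R}$, and let $q^s(x)=[\mathtt{q}^s(x_1),\dots,\mathtt{q}^s(x_n)]^\top$ for $x\in\mathbb{R}^n$. Then every Filippov solution $x:[0,\infty)\to\mathbb{R}^n$ of $$\dot x=-L\,q^s(x)$$ converges asymptotically (as $t\to\infty$, in the sense that its distance to the set tends to $0$) to the set $$\mathcal{D}_2=\left\{x\in\mathbb{R}^n\mid \exists k\in\mathbb{Z}\ \text{such that}\ (k-\tfrac12)\Delta\le x_i\le (k+\tfrac12)\Delta\ \text{for all } i=1,\dots,n\right\}.$$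
   Context: Weighted digraph: node set $\mathcal{V}=\{v_1,\dots,v_n\}$, edge set $\mathcal{E}\subseteq\mathcal{V}\times\mathcal{V}$, adjacency matrix $A=[a_{ij}]$ with $a_{ij}\ge 0$, $a_{ii}=0$, and $a_{ij}>0$ if and only if $(v_j,v_i)\in\mathcal{E}$. The graph Laplacian is $L=D-A$, where $D$ is diagonal with $D_{ii}=\sum_{j}a_{ij}$. The digraph contains a directed spanning tree if there is a node (a root) from which there is a directed path to every other node. For a map $X:\mathbb{R}^n\to\mathbb{R}^n$ the Filippov set-valued map is $\mathcal{F}[X](x)=\bigcap_{\delta>0}\bigcap_{\mu(S)=0}\overline{\mathrm{co}}\{X(B(x,\delta)\setminus S)\}$, where $B(x,\delta)$ is the open ball, $\mu$ is Lebesgue measure and $\overline{\mathrm{co}}$ is the closed convex hull. A Filippov solution of $\dot x=X(x)$ is a (locally) absolutely continuous function $x(t)$ with $\dot x(t)\in\mathcal{F}[X](x(t))$ for almost every $t$. *)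

(* Defs.v *)
From HB Require Import structures.
From mathcomp Require Import all_boot all_order all_algebra.
From mathcomp Require Import all_classical all_reals all_analysis.

Set Implicit Arguments.
Unset Strict Implicit.
Unset Printing Implicit Defensive.

Import Order.TTheory GRing.Theory Num.Theory.
Import numFieldNormedType.Exports.

Local Open Scope classical_set_scope.
Local Open Scope ring_scope.

Section WeightedDigraph.
Context (R : realType) (n : nat).

Record weighted_digraph := WeightedDigraph {
  edge : rel 'I_n;
  adj : 'M[R]_n;
  adj_ge0 : forall i j, 0 <= adj i j;
  adj_diag : forall i, adj i i = 0;
  (* a_ij is the weight of the edge from v_j to v_i, hence the swap. *)
  adj_edge : forall i j, 0 < adj i j <-> edge j i }.

Definition laplacian (G : weighted_digraph) : 'M[R]_n :=
  diag_mx (\row_i \sum_j adj G i j) - adj G.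

Definition has_spanning_tree (G : weighted_digraph) : Prop :=
  exists r : 'I_n, forall v : 'I_n, connect (edge G) r v.

End WeightedDigraph.

Section Euclidean.
Context (R : realType) (n : nat).
Implicit Types (x y : 'cV[R]_n) (S : set 'cV[R]_n).

(* The library norms matrices by the sup norm; the balls and distances used
   here are Euclidean. The two norms induce the same topology. *)
Definition enorm x : R := Num.sqrt (\sum_i x i ord0 ^+ 2).

Definition eball x (r : R) : set 'cV[R]_n := [set y | enorm (y - x) < r].

(* Only meaningful when S is nonempty: inf set0 = 0. *)
Definition dist_to_set S x : R := inf [set enorm (x - y) | y in S].

Definition box x y : set 'cV[R]_n :=
  [set z | forall i, x i ord0 <= z i ord0 <= y i ord0].

Definition box_volume x y : R := \prod_i Num.max 0 (y i ord0 - x i ord0).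

(* The library has no Lebesgue measure on R^n, so null sets are those of zero
   Lebesgue outer measure, defined by countable covers by closed boxes. *)
Definition lebesgue_outer_measure S : \bar R :=
  ereal_inf [set (\sum_(0 <= k <oo) (box_volume (b k).1 (b k).2)%:E)%E
            | b in [set b : nat -> 'cV[R]_n * 'cV[R]_n
                   | S `<=` \bigcup_k box (b k).1 (b k).2]].

Definition lebesgue_null S : Prop := lebesgue_outer_measure S = 0%E.

Definition closed_convex_hull S : set 'cV[R]_n :=
  smallest [set C : set 'cV[R]_n | closed C /\ convex_set C] S.

End Euclidean.

Section Filippov.
Context (R : realType) (n : nat).

Definition filippov_map (X : 'cV[R]_n -> 'cV[R]_n) (x : 'cV[R]_n) :
    set 'cV[R]_n :=
  \bigcap_(d in [set d : R | 0 < d])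
    \bigcap_(S in [set S : set 'cV[R]_n | lebesgue_null S])
      closed_convex_hull (X @` (eball x d `\` S)).

Definition absolutely_continuous_on (a b : R) (x : R -> 'cV[R]_n) : Prop :=
  forall e : R, 0 < e -> exists2 d : R, 0 < d &
    forall (m : nat) (s t : 'I_m -> R),
      (forall k, [/\ a <= s k, s k <= t k & t k <= b]) ->
      trivIset setT (fun k => `]s k, t k[%classic) ->
      \sum_k (t k - s k) < d -> \sum_k enorm (x (t k) - x (s k)) < e.

(* Solutions live on [0, +oo[; the values of x at negative times are
   irrelevant, and derivatives are two-sided ones at times t > 0. *)
Definition filippov_solution (X : 'cV[R]_n -> 'cV[R]_n) (x : R -> 'cV[R]_n) :
    Prop :=
  (forall T : R, 0 < T -> absolutely_continuous_on 0 T x) /\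
  {ae (@lebesgue_measure R), forall t : R, 0 < t ->
    derivable x t 1 /\ filippov_map X (x t) ('D_1 x t)}.

End Filippov.

Section Quantizer.
Context (R : realType).

Definition quantizer (Delta z : R) : R :=
  (Num.floor (z / Delta + 2^-1))%:~R * Delta.

Definition quantizer_vec n (Delta : R) (x : 'cV[R]_n) : 'cV[R]_n :=
  \col_i quantizer Delta (x i ord0).

Definition D2 n (Delta : R) : set 'cV[R]_n :=
  [set x | exists k : int, forall i,
    (k%:~R - 2^-1) * Delta <= x i ord0 <= (k%:~R + 2^-1) * Delta].

End Quantizer.

(* Main.v *)
Require Import Defs.
From mathcomp Require Import all_boot all_order all_algebra.
From mathcomp Require Import all_classical all_reals all_analysis.
From mathcomp Require Import ring lra zify.
Import Order.TTheory GRing.Theory Num.Theory.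
Import numFieldNormedType.Exports.
Local Open Scope classical_set_scope.
Local Open Scope ring_scope.

(* Along a Filippov solution, x_i' = sum_j a_ij (v_j - v_i) for almost every t,
   with v_i between the one-sided limits of the quantizer at x_i.

   Every cell boundary (k + 1/2) D is a forward invariant upper bound, so there
   is a lowest one, (K + 1/2) D, that all agents eventually stay below, and at
   every time some agent is above (K - 1/2) D. If the root agent r does not sit
   on (K + 1/2) D for ever, then eventually v <= K D and a fixed agent stays
   above (K - 1/2) D; following a path from r to that agent yields a linear
   combination of the x_i decreasing at rate at least c (K D - v_r), c > 0. If r
   sits there, then v_r >= K D and the zero combination will do. Symmetrically,
   with (K' - 1/2) D the highest eventual lower
   bound, another one increases at rate at least c' (v_r - K' D). If K' < K,
   then combining both eliminates v_r and gives a bounded quantity that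
   decreases at a positive rate. Hence K <= K', which confines all the agents to
   one closed cell after a finite time. *)

(** * Real induction and the Euclidean norm *)

(** The supremum of the points satisfying [P] satisfies it too and cannot lie below [b]. Stepping
    from the left of [t] to its right covers limits and progress in one hypothesis. *)
Lemma segment_induction (R : realType) (a b : R) (P : R -> Prop) :
    a <= b -> P a ->
    (forall t, a <= t <= b -> exists2 d, 0 < d & forall u s, a <= u <= t ->
       t <= s <= b -> t - d < u -> s < t + d -> P u -> P s) ->
  P b.
Proof.
move=> ab Pa step; pose E := [set t | a <= t <= b /\ P t].
have Ea : E a by split; rewrite ?lexx.
have supE : has_sup E by split; [exists a | exists b => t [/andP[]]].
have aE : a <= sup E by apply: sup_upper_bound.
have Eb : sup E <= b by apply: sup_le_ub; [exists a | move=> t [/andP[]]].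
have /step [d d0 {}step] : a <= sup E <= b by rewrite aE.
have [u [/andP[au ub] Pu] du] := sup_adherent d0 supE.
have uE : u <= sup E by apply: sup_upper_bound => //; split; rewrite ?au.
have {}step s : sup E <= s <= b -> s < sup E + d -> P s.
  by move=> ? ?; apply: (step u) => //; rewrite au.
have [bE|Eb'] := leP b (sup E); first by apply: step; lra.
pose s := Num.min b (sup E + d / 2).
have Es : sup E < s by rewrite lt_min Eb'/=; lra.
have sb : s <= b by rewrite ge_min lexx.
have sd : s < sup E + d by rewrite gt_min; apply/orP; right; lra.
suff /(sup_upper_bound supE) : E s by rewrite leNgt Es.
by split; [lra | apply: step => //; lra].
Qed.

Lemma enorm_ge0 (R : realType) n (x : 'cV[R]_n) : 0 <= enorm x.
Proof. exact: sqrtr_ge0. Qed.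

Lemma coord_le_enorm (R : realType) n (x : 'cV[R]_n) i :
  `|x i ord0| <= enorm x.
Proof.
rewrite /enorm -sqrtr_sqr ler_wsqrtr// (bigD1 i)//= lerDl.
by apply: sumr_ge0 => j _; exact: sqr_ge0.
Qed.

Lemma absolutely_continuous_on_sub (R : realType) n (x : R -> 'cV[R]_n)
    (a b a' b' : R) : a <= a' -> b' <= b ->
  absolutely_continuous_on a b x -> absolutely_continuous_on a' b' x.
Proof.
move=> aa' bb' ac e /ac[d d0 {}ac]; exists d => // m s t st; apply: ac => k.
by have [] := st k; split=> //; lra.
Qed.

(** * Integration of slope bounds valid almost everywhere *)

Section increments.
Context (R : realType).
Notation mu := (@lebesgue_measure R).

Lemma negligible_open_cover (N : set R) (e : R) : mu.-negligible N -> 0 < e ->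
  exists U, [/\ open U, N `<=` U & (mu U < e%:E)%E].
Proof.
move=> [A [mA A0 NA]] e0.
have [|U [oU AU Ue]] := lebesgue_regularity_outer mA _ e0.
  by rewrite [X in (X < _)%E](_ : _ = 0%E) ?ltry//; exact: A0.
exists U; split => //; first exact: subset_trans NA AU.
have mU : measurable U by exact: measurable_realfun.open_measurable.
rewrite -(setDUK AU) measureU//; last 2 first.
- by apply: measurableD.
- by rewrite setDE setICA setICr setI0.
by rewrite [X in (X + _)%E](_ : _ = 0%E) ?add0e//; exact: A0.
Qed.

(** Bookkeeping for one more exceptional interval: []u, s]] is disjoint from [[a, u]], so the part
    of [U] consumed grows by its full length. *)
Lemma measure_segment_adjoin (U : set R) (a u s t : R) : open U ->
    a <= u -> u <= t -> t <= s -> `]u, s] `<=` U ->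
  (mu (U `&` `[a, u]) + (s - u)%:E <= mu (U `&` `[a, s]))%E.
Proof.
move=> oU au ut ts usU.
have mU : measurable U by exact: measurable_realfun.open_measurable.
have -> : (s - u)%:E = mu `]u, s].
  rewrite lebesgue_measure_itv/= lte_fin EFinB.
  case: ltP => // su; have -> : u = s by lra.
  by rewrite subee.
rewrite -measureU//; last 2 first.
- exact: measurableI.
- by apply/seteqP; split => z//= -[[_]]; rewrite !in_itv/=; lra.
apply: le_measure; rewrite ?inE//.
- by apply: measurableU => //; exact: measurableI.
- exact: measurableI.
by move=> z [[Uz zb]|/= zu]; split; rewrite //= ?in_itv/=; first 1 last;
  [exact: usU | move: zu; rewrite in_itv/=; lra | move: zb; rewrite /= in_itv/=; lra].
Qed.

End increments.

(* Outside the null set N the increments are controlled by the slope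
   condition; N is covered by an open set of small measure, on which they are
   controlled by absolute continuity. *)
Lemma ac_increment_le (R : realType) n (x : R -> 'cV[R]_n) (a b C M : R)
    (g : R -> R) (N : set R) :
    a <= b -> 0 <= C -> absolutely_continuous_on a b x ->
    (forall s u, `|g s - g u| <= C * enorm (x s - x u)) ->
    (@lebesgue_measure R).-negligible N ->
    (forall t, a <= t <= b -> ~ N t -> forall e, 0 < e -> exists2 d, 0 < d &
       forall u s, a <= u <= t -> t <= s <= b -> t - d < u -> s < t + d ->
         g s - g u <= (M + e) * (s - u)) ->
  g b - g a <= M * (b - a).
Proof.
move=> ab C0 ac glip N0 slope; apply/ler_addgt0Pl => e e0.
(* The error [e] is split in thirds: the slack in the slope, [C] times the variation of [x] on the
   exceptional intervals, and [|M'|] times their total length. *)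
pose e1 := e / 3 / (b - a + 1); have e10 : 0 < e1 by rewrite !divr_gt0//; lra.
have e1b : e1 * (b - a) <= e / 3.
  rewrite /e1 -mulrA ger_pMr; last lra.
  by rewrite mulrC ler_pdivrMr; lra.
pose M' := M + e1.
pose e2 := e / 3 / (C + 1); have e20 : 0 < e2 by rewrite !divr_gt0//; lra.
have e2C : C * e2 <= e / 3.
  by rewrite /e2 mulrCA ger_pMr ?divr_gt0// ler_pdivrMr; lra.
have M'0 : 0 <= `|M'| by [].
have [d1 d10 {}ac] := ac _ e20.
pose d2 := e / 3 / (`|M'| + 1).
have d20 : 0 < d2 by rewrite !divr_gt0//; lra.
have d2M : `|M'| * d2 <= e / 3.
  by rewrite /d2 mulrCA ger_pMr ?divr_gt0// ler_pdivrMr; lra.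
pose d := Num.min d1 d2.
have d0 : 0 < d by rewrite lt_min d10.
have [U [oU NU Ud]] := negligible_open_cover _ _ _ N0 d0.
(* The intervals [[p k, q k]] are the steps taken across points of [N]. The slope [M'] is charged on
   them as well; the term in [|M'|] compensates for this when [M'] is negative. *)
pose P (t : R) := exists m (p q : nat -> R),
  [/\ forall k, (k < m)%N -> a <= p k <= q k /\ q k <= t,
      forall i j, (i < j)%N -> (j < m)%N -> q i <= p j,
      ((\sum_(k < m) (q k - p k))%:E <= lebesgue_measure (U `&` `[a, t]))%E &
      g t - g a <= M' * (t - a) + \sum_(k < m)
        (C * enorm (x (q k) - x (p k)) + `|M'| * (q k - p k))].
have mU : measurable U by exact: measurable_realfun.open_measurable.
suff [m [p [q [pq qp sumU gb]]]] : P b.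
  have sumd : \sum_(k < m) (q k - p k) < d.
    rewrite -lte_fin; apply: le_lt_trans sumU _; apply: le_lt_trans Ud.
    by apply: le_measure; rewrite ?inE//; exact: measurableI.
  have : \sum_(k < m) enorm (x (q k) - x (p k)) < e2.
    apply: (ac m (p \o @nat_of_ord m) (q \o @nat_of_ord m)) => [k|i j _ _|].
    - by have [//|/andP[? ?] ?] := pq k _; split.
    - move=> [z []] /=; rewrite !in_itv/= => /andP[iz zi] /andP[jz zj].
      apply/val_inj => /=; case: (ltngtP i j) => // ij.
      + by have := lt_trans jz (lt_le_trans zi (qp _ _ ij (ltn_ord j))); rewrite ltxx.
      + by have := lt_trans iz (lt_le_trans zj (qp _ _ ij (ltn_ord i))); rewrite ltxx.
    - by apply: lt_le_trans sumd _; rewrite ge_min lexx.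
  move: gb; rewrite big_split/= -!mulr_sumr => gb sume.
  have := ler_wpM2l C0 (ltW sume).
  have : `|M'| * \sum_(k < m) (q k - p k) <= `|M'| * d2.
    by rewrite ler_wpM2l// (le_trans (ltW sumd))// ge_min lexx orbT.
  by move: gb; rewrite /M' mulrDl; lra.
apply: (segment_induction _ a) => //.
  exists 0%N, (fun=> 0), (fun=> 0); split => //.
  - by rewrite big_ord0; exact: measure_ge0.
  - by rewrite big_ord0 !subrr mulr0 addr0.
move=> t tab; have [Nt|Nt] := pselect (N t).
  have [r r0 rU] : exists2 r, 0 < r & `]t - r, t + r[ `<=` U.
    have /nbhs_ballP[r r0 rU] := open_nbhs_nbhs (conj oU (NU _ Nt)).
    exists r => // z zr; apply: rU; rewrite -ball_normE/= ltr_norml.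
    by move: zr; rewrite /= in_itv/=; lra.
  exists r => // u s atu tsb ru sr [m [p [q [pq qp sumU gb]]]].
  exists m.+1, (fun k => if k == m then u else p k),
         (fun k => if k == m then s else q k).
  have eqm (k : 'I_m) : (k == m :> nat) = false.
    by apply/negbTE; rewrite neq_ltn ltn_ord.
  rewrite !big_ord_recr/= eqxx; split.
  - move=> k; rewrite ltnS leq_eqVlt; case: eqVneq => /= [_ _|_ km]; first lra.
    by have := pq _ km; lra.
  - move=> i j ij; rewrite ltnS leq_eqVlt.
    case: eqVneq ij => [-> im _|_ ij /= jm].
      by rewrite ltn_eqF//; have [/andP[_ _] /le_trans] := pq _ im; apply; lra.
    by rewrite ltn_eqF ?qp// (ltn_trans ij).
  - under eq_bigr do rewrite eqm.
    rewrite EFinD; apply: le_trans (measure_segment_adjoin _ U a u s t oU _ _ _ _).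
    + by rewrite leeD.
    + lra.
    + lra.
    + lra.
    + by move=> z zus; apply: rU; move: zus; rewrite /= !in_itv/=; lra.
  - under eq_bigr do rewrite eqm.
    have := glip s u; have := ler_norm (g s - g u).
    have : M' * (s - a) = M' * (u - a) + M' * (s - u) by ring.
    have : - M' * (s - u) <= `|M'| * (s - u).
      by rewrite ler_wpM2r ?subr_ge0; [|lra|rewrite -normrN ler_norm].
    by lra.
have [r r0 rs] := slope t tab Nt e1 e10.
exists r => // u s atu tsb ru sr [m [p [q [pq qp sumU gb]]]].
exists m, p, q; split => //.
- by move=> k km; have := pq k km; lra.
- apply: le_trans sumU _; apply: le_measure; rewrite ?inE.
  + exact: measurableI.
  + exact: measurableI.
  + by apply: setIS => z; rewrite /= !in_itv/=; lra.
- have := rs u s atu tsb ru sr; rewrite -/M'.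
  have : M' * (s - a) = M' * (u - a) + M' * (s - u) by ring.
  by lra.
Qed.

(* [quantized D z] is the interval of limit values of the quantizer at [z]:
   one value inside a cell, and the convex hull of the two adjacent values at a
   cell boundary. *)
Definition quantized {R : realType} (D z v : R) : Prop :=
  forall k : int, ((k%:~R - 2^-1) * D < z -> k%:~R * D <= v) /\
                  (z < (k%:~R + 2^-1) * D -> v <= k%:~R * D).

(** The quantizer is not odd, since it rounds every boundary up, but its limit values are symmetric.
    Upper bounds on solutions thus yield lower bounds. *)
Lemma quantizedN {R : realType} {D z v : R} :
  quantized D z v -> quantized D (- z) (- v).
Proof.
move=> qzv k; have := qzv (- k); rewrite mulrNz => -[h1 h2]; split => kz.
- have : v <= - k%:~R * D by apply: h2; lra.
  by lra.
- have : - k%:~R * D <= v by apply: h1; lra.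
  by lra.
Qed.

Lemma quantizer_near {R : realType} {D : R} (z : R) : 0 < D ->
  exists lo hi d, [/\ forall v, lo <= v <= hi -> quantized D z v, 0 < d &
    forall y, `|y - z| < d -> lo <= quantizer D y <= hi].
Proof.
move=> D0.
(* [m] and [p] are the least and the greatest integer at distance at most 1/2 from [z / D]; they
   differ only at a cell boundary. The radius chosen below is the distance from [z] to the nearer
   end of the union of cells [m] and [p]. *)
pose m := Num.ceil (z / D - 2^-1); pose p := Num.floor (z / D + 2^-1).
have /andP[m1 m2] := ceil_itv (z / D - 2^-1); rewrite -/m in m1 m2.
have /andP[p1 p2] := floor_itv (z / D + 2^-1); rewrite -/p in p1 p2.
rewrite !intrD/= in m1 p2; rewrite mulrNz in m1.
exists (m%:~R * D), (p%:~R * D),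
  (Num.min ((z / D + 2^-1 - m%:~R) * D) ((p%:~R + 2^-1 - z / D) * D)).
split.
- move=> v /andP[mv vp] k; split => kz.
  + apply: le_trans mv; rewrite ler_pM2r// ler_int.
    have : k%:~R - 2^-1 < z / D by rewrite ltr_pdivlMr.
    by rewrite -[k](subrK 1) lezD1 ceil_gt_int intrB; lra.
  + apply: le_trans vp _; rewrite ler_pM2r// ler_int.
    have : z / D < k%:~R + 2^-1 by rewrite ltr_pdivrMr.
    by rewrite -ltzD1 floor_lt_int intrD; lra.
- by rewrite lt_min !mulr_gt0//; lra.
- move=> y; rewrite lt_min => /andP[]; rewrite !ltr_norml => /andP[h1 _] /andP[_ h2].
  have {}h1 : - (z / D + 2^-1 - m%:~R) < y / D - z / D.
    by rewrite -mulrBl ltr_pdivlMr// mulNr.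
  have {}h2 : y / D - z / D < p%:~R + 2^-1 - z / D by rewrite -mulrBl ltr_pdivrMr.
  rewrite /quantizer.
  rewrite !ler_pM2r// !ler_int floor_ge_int; apply/andP; split; first lra.
  by rewrite -ltzD1 floor_lt_int intrD; lra.
Qed.

(** For [n = 0] every box has volume 1, the empty product, so every countable cover has infinite
    total volume. *)
Lemma lebesgue_null0 (R : realType) n :
  (0 < n)%N -> lebesgue_null (set0 : set 'cV[R]_n).
Proof.
move=> n0; apply/eqP; rewrite eq_le; apply/andP; split.
  apply: ereal_inf_lbound; exists (fun=> (0, 0)); first by move=> ?.
  apply: eseries0 => k _ _; rewrite /box_volume /=; congr (_%:E).
  by case: n n0 => // n _; rewrite big_ord_recl !mxE subrr maxxx mul0r.
apply: le_ereal_inf_tmp => _ [b _ <-]; apply: nneseries_ge0 => k _ _.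
by rewrite lee_fin; apply: prodr_ge0 => i _; rewrite le_max lexx.
Qed.

Section consensus_map.
Context {R : realType} {n : nat} (G : weighted_digraph R n).

Definition consensus (v : 'I_n -> R) (i : 'I_n) : R :=
  \sum_j adj G i j * (v j - v i).

Lemma laplacian_consensus (v : 'cV[R]_n) i :
  (- laplacian G *m v) i ord0 = consensus (fun j => v j ord0) i.
Proof.
rewrite /laplacian opprB mulmxBl mul_diag_mx !mxE mulr_suml -sumrB.
by apply: eq_bigr => j _; rewrite mulrBr.
Qed.

Lemma consensusN v : consensus (fun i => - v i) = (fun i => - consensus v i).
Proof.
by apply/funext => i; rewrite /consensus -sumrN; apply: eq_bigr => j _; ring.
Qed.

(** The set is the continuous image of a product of segments, hence compact. Rows replace columns to
    match [rV_compact]. *)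
Lemma closed_consensus_box (lo hi : 'I_n -> R) :
  closed [set d : 'cV[R]_n | exists2 v, forall i, lo i <= v i <= hi i &
                             forall i, d i ord0 = consensus v i].
Proof.
pose f (v : 'rV[R]_n) : 'cV[R]_n := \col_i consensus (v ord0) i.
rewrite (_ : mkset _ = f @` [set v : 'rV[R]_n | forall i, `[lo i, hi i]%classic (v ord0 i)]).
  apply: compact_closed; first exact: norm_hausdorff.
  apply: continuous_compact; last first.
    apply: (@rV_compact R n (fun i => `[lo i, hi i]%classic)) => i.
    exact: segment_compact.
  apply: continuous_subspaceT => v A [P vP PA].
  have : \forall w \near v, forall i j, P i j (f w i j); last first.
    by apply: filterS => w; exact: PA.
  apply: (@filter_forall _ _ (fun i w => forall j, P i j (f w i j)) (nbhs v)) => i.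
  apply: (@filter_forall _ _ (fun j w => P i j (f w i j)) (nbhs v)) => j.
  suff cf : continuous (fun w : 'rV[R]_n => f w i j) by exact: cf (vP i j).
  move=> w; under [X in continuous_at _ X]eq_fun do rewrite mxE.
  apply: continuous_big => [|k _ {}w]; first exact: add_continuous.
  have ck := @coord_continuous R 1 n ord0 k w.
  have ci := @coord_continuous R 1 n ord0 i w.
  exact: (cvgM (cvg_cst (adj G i k)) (cvgB ck ci)).
apply/seteqP; split => [d [v vb dv]|_ [v vb <-]].
  exists (\row_i v i) => [i|]; first by rewrite /= in_itv/= mxE.
  apply/colP => i; rewrite !mxE dv; congr consensus.
  by apply/funext => j; rewrite mxE.
exists (v ord0) => [i|i]; last by rewrite mxE.
by have := vb i; rewrite /= in_itv.
Qed.

Lemma convex_consensus_box (lo hi : 'I_n -> R) :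
  convex_set [set d : 'cV[R]_n | exists2 v, forall i, lo i <= v i <= hi i &
                                 forall i, d i ord0 = consensus v i].
Proof.
move=> d1 d2 l; rewrite !inE => -[v1 vb1 dv1] [v2 vb2 dv2].
exists (fun i => l%:num * v1 i + (1 - l%:num) * v2 i) => i.
  have l0 : 0 <= l%:num by [].
  have l1 : l%:num <= 1 by [].
  by have := vb1 i; have := vb2 i; nra.
rewrite !mxE dv1 dv2 /consensus !mulr_sumr -big_split/=.
by apply: eq_bigr => j _ /=; rewrite /unstable.onem; ring.
Qed.

(** On a small ball the quantized vectors stay in a box, whose image under the linear consensus map
    is closed and convex and so contains the hull. The empty null set suffices, and one [v] serves
    all coordinates. *)
Lemma filippov_quantized_consensus (D : R) (x d : 'cV[R]_n) :
    (0 < n)%N -> 0 < D ->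
    filippov_map (fun y => - laplacian G *m quantizer_vec D y) x d ->
  exists2 v, forall i, quantized D (x i ord0) (v i) &
             forall i, d i ord0 = consensus v i.
Proof.
move=> n0 D0 Fd.
have /choice[lo /choice[hi /choice[r loP]]] i := quantizer_near (x i ord0) D0.
pose e := \big[Num.min/1]_i r i.
have e0 : 0 < e by apply: lt_bigmin => // i _; have [] := loP i.
have /(_ [set d : 'cV[R]_n | exists2 v, forall i, lo i <= v i <= hi i &
                             forall i, d i ord0 = consensus v i]) :=
  Fd e e0 _ (lebesgue_null0 _ _ n0).
move=> []; [split; first split; [exact: closed_consensus_box | exact: convex_consensus_box |]|].
  move=> _ [y [ye _] <-]; exists (fun i => quantizer D (y i ord0)) => i.
    have [_ _] := loP i; apply; apply: (lt_le_trans _ (bigmin_le 1 i r)).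
    by apply: le_lt_trans ye; have := coord_le_enorm _ _ (y - x) i; rewrite !mxE.
  by rewrite laplacian_consensus; congr consensus; apply/funext => j; rewrite mxE.
by move=> v vb dv; exists v => // i; have [+ _ _] := loP i; apply.
Qed.

End consensus_map.

(** * Pointwise consequences of continuity and differentiability *)

Lemma ac_uniformly_continuous {R : realType} {n : nat} {x : R -> 'cV[R]_n}
    {a b e : R} : absolutely_continuous_on a b x -> 0 < e ->
  exists2 d, 0 < d & forall u s, a <= u -> u <= s -> s <= b -> s - u < d ->
    enorm (x s - x u) < e.
Proof.
move=> ac /ac[d d0 {}ac]; exists d => // u s au us sb sud.
have := ac 1%N (fun=> u) (fun=> s); rewrite !big_ord1; apply=> //.
by move=> i j _ _ _; rewrite !ord1.
Qed.

Lemma is_derive_approx {R : realType} {f : R -> R} {t l e : R} :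
    is_derive t 1 f l -> 0 < e ->
  exists2 d, 0 < d & forall s, `|s - t| < d ->
    `|f s - f t - l * (s - t)| <= e * `|s - t|.
Proof.
move=> [df fl] e0; have := df; rewrite /derivable => /cvg_ex[l' fl'].
have {fl} l'E : l' = l by rewrite -fl; apply/esym/cvg_lim.
rewrite {}l'E in fl'; move/cvgrPdist_le : fl' => /(_ e e0)[d /= d0 fd].
exists d => // s sd; have [->|st] := eqVneq s t.
  by rewrite !subrr mulr0 subr0 normr0 mulr0.
have st0 : s - t != 0 by rewrite subr_eq0.
have := fd (s - t); rewrite /= sub0r normrN => /(_ sd st0).
rewrite /GRing.scale/= mulr1 subrK => fst.
rewrite (_ : _ - _ = - (l - (s - t)^-1 * (f s - f t)) * (s - t)); last by field.
by rewrite normrM normrN ler_wpM2r.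
Qed.

(** Both end points may move because [t] separates them; [ac_increment_le] asks for slopes in this
    form. *)
Lemma slope_le {R : realType} {f : R -> R} {t l M e : R} :
    is_derive t 1 f l -> l <= M -> 0 < e ->
  exists2 d, 0 < d & forall u s, u <= t <= s -> t - d < u -> s < t + d ->
    f s - f u <= (M + e) * (s - u).
Proof.
move=> fl lM e0; have [d d0 fd] := is_derive_approx fl e0.
exists d => // u s uts ud sd.
have := fd u; rewrite ltr_norml ler_norml ler0_norm; last lra.
have := fd s; rewrite ltr_norml ler_norml ger0_norm; last lra.
move=> /(_ ltac:(lra)) h1 /(_ ltac:(lra)) h2.
have : l * (s - u) <= M * (s - u) by rewrite ler_wpM2r//; lra.
by lra.
Qed.

Lemma is_derive_max {R : realType} {f : R -> R} {T t l : R} :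
    T < t -> (forall s, T < s -> f s <= f t) -> is_derive t 1 f l -> l = 0.
Proof.
move=> Tt fmax fl; apply/eqP; apply: contraT => l0.
have l2 : 0 < `|l| / 2 by rewrite divr_gt0// normr_gt0.
have [d d0 fd] := is_derive_approx fl l2.
pose m := Num.min d (t - T); pose h := m / 2.
have m0 : 0 < m by rewrite lt_min d0 subr_gt0.
have md : m <= d by rewrite ge_min lexx.
have mT : m <= t - T by rewrite ge_min lexx orbT.
have h0 : 0 < h by rewrite divr_gt0.
have hd : h < d by rewrite /h; lra.
have hT : h < t - T by rewrite /h; lra.
have f1 := fmax (t + h) ltac:(lra); have f2 := fmax (t - h) ltac:(lra).
have := fd (t + h); have := fd (t - h).
have -> : t - h - t = - h by ring.
have -> : t + h - t = h by ring.
rewrite normrN (ger0_norm (ltW h0)) !ler_norml => /(_ hd) h1 /(_ hd) h2.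
have [l1|l1] := leP 0 l.
- by move: l0 h2; rewrite ger0_norm// neq_lt; nra.
- by move: h1; rewrite ltr0_norm//; nra.
Qed.

(** * Inequalities for the consensus map along paths *)

Section consensus.
Context {R : realType} {n : nat} (G : weighted_digraph R n).

Lemma consensus_le0 (v : 'I_n -> R) i :
  (forall j, v j <= v i) -> consensus G v i <= 0.
Proof.
move=> vi; apply: sumr_le0 => j _.
by rewrite mulr_ge0_le0 ?adj_ge0// subr_le0.
Qed.

(** Write [v j - v i] as [(K - v i) - (K - v j)] and keep only [j = r] in the second sum. *)
Lemma consensus_le (v : 'I_n -> R) (K : R) i r : (forall j, v j <= K) ->
  consensus G v i <= (\sum_j adj G i j) * (K - v i) - adj G i r * (K - v r).
Proof.
move=> vK; rewrite /consensus mulr_suml (bigD1 r)//= [in leRHS](bigD1 r)//=.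
rewrite [leRHS]addrAC lerD//; first by rewrite -mulrBr (_ : K - _ - _ = v r - v i)//; ring.
by apply: ler_sum => j _; rewrite ler_wpM2l ?adj_ge0// lerB.
Qed.

(** A maximal node at rest has only maximal in-neighbours, so maximality travels back along the path
    to the root. *)
Lemma consensus_max_root (v : 'I_n -> R) (M : R) r i :
    (forall j, v j <= M) -> (forall j, v j = M -> consensus G v j = 0) ->
    connect (edge G) r i -> v i = M -> v r = M.
Proof.
move=> vM cM /connectP[p + ->]; elim: p r => //= j p IH r /andP[/(adj_edge G) a0 jp] vi.
have {}IH := IH j jp vi; have := consensus_le v M j r vM.
rewrite cM// IH subrr mulr0 sub0r oppr_ge0 pmulr_rle0// subr_le0 => Mr.
by apply/eqP; rewrite eq_le Mr vM.
Qed.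

(** Induction on the path. For an edge from [r] to [j], [consensus_le] at [j], scaled by [c],
    contributes [c * (K - v j)] times the in-degree of [j]; this cancels the bound known for [j],
    scaled by that in-degree, and leaves [- c * adj G j r * (K - v r)]. *)
Lemma consensus_certificate r i : connect (edge G) r i ->
  exists (w : 'I_n -> R) (c : R), 0 < c /\ forall v K, (forall j, v j <= K) ->
    K <= v i -> \sum_k w k * consensus G v k <= - c * (K - v r).
Proof.
move=> /connectP[p + ->]; elim: p r => [r _|j p IH r] /=.
  exists (fun=> 0), 1; split => // v K _ Kv.
  by rewrite big1 => [|k _]; rewrite ?mul0r//; lra.
move=> /andP[/(adj_edge G) a0 /IH[w [c [c0 {}IH]]]].
exists (fun k => (\sum_l adj G j l) * w k + (k == j)%:R * c), (c * adj G j r).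
split => [|v K vK Kv]; first exact: mulr_gt0.
have -> : \sum_k ((\sum_l adj G j l) * w k + (k == j)%:R * c) * consensus G v k =
    (\sum_l adj G j l) * (\sum_k w k * consensus G v k) + c * consensus G v j.
  under eq_bigr do rewrite mulrDl -mulrA -(mulrA _ c).
  rewrite big_split/= -mulr_sumr; congr +%R.
  by rewrite (bigD1 j)//= eqxx mul1r big1 ?addr0// => k /negbTE->; rewrite mul0r.
have d0 : 0 <= \sum_l adj G j l by apply: sumr_ge0 => l _; exact: adj_ge0.
have := ler_wpM2l d0 (IH v K vK Kv).
have := ler_wpM2l (ltW c0) (consensus_le v K j r vK).
by lra.
Qed.

End consensus.

(** * Invariant ceilings of quantized solutions *)

Section quantized_solutions.
Context {R : realType} {n : nat} (G : weighted_digraph R n) (D : R).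
Implicit Types (x : R -> 'cV[R]_n) (v : 'I_n -> R) (K : int).

Definition quantized_velocity x t v : Prop :=
  (forall i, quantized D (x t i ord0) (v i)) /\
  forall i, is_derive t 1 (fun s => x s i ord0) (consensus G v i).

Definition quantized_solution x : Prop :=
  (forall T : R, 0 < T -> absolutely_continuous_on 0 T x) /\
  exists2 N, (@lebesgue_measure R).-negligible N &
    forall t, 0 < t -> ~ N t -> exists v, quantized_velocity x t v.

Lemma quantized_velocityN x t v : quantized_velocity x t v ->
  quantized_velocity (fun s => - x s) t (fun i => - v i).
Proof.
move=> [qv dv]; split => i; first by rewrite mxE; exact: quantizedN.
rewrite consensusN; under eq_fun do rewrite mxE.
exact: is_deriveN.
Qed.

Lemma quantized_solutionN x :
  quantized_solution x -> quantized_solution (fun s => - x s).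
Proof.
move=> [ac [N N0 xN]]; split=> [T T0 e e0|].
  have [d d0 {}ac] := ac T T0 e e0; exists d => // m s t st dst sd.
  apply: le_lt_trans (ac m s t st dst sd); apply: ler_sum => k _.
  rewrite -opprD /enorm le_eqVlt; apply/orP; left; apply/eqP; congr Num.sqrt.
  by apply: eq_bigr => i _; rewrite !mxE sqrrN.
exists N => // t t0 Nt; have [v xv] := xN t t0 Nt.
by exists (fun i => - v i); exact: quantized_velocityN.
Qed.

Lemma filippov_quantized_solution (D0 : 0 < D) x : (0 < n)%N ->
    filippov_solution (fun y => - laplacian G *m quantizer_vec D y) x ->
  quantized_solution x.
Proof.
move=> n0 [ac ae]; split => //; exists (~` [set t : R | 0 < t ->
  derivable x t 1 /\ filippov_map (fun y => - laplacian G *m quantizer_vec D y)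
    (x t) ('D_1 x t)]) => // t t0 /contrapT /(_ t0)[dx].
move=> /filippov_quantized_consensus[//|//|v qv dv]; exists v; split => // i.
have dxi : derivable (fun s => x s i ord0) t 1 by exact: (derivable_mxP x t 1).1.
by apply: DeriveDef => //; rewrite -dv derive_mx// mxE.
Qed.

Lemma quantized_solution_ac x a b : quantized_solution x -> 0 < a -> a <= b ->
  absolutely_continuous_on a b x.
Proof.
move=> [ac _] a0 ab; have b0 : 0 < b by lra.
by apply: absolutely_continuous_on_sub (ac b b0); lra.
Qed.

(** The truncation [g] has slope at most 0: where it exceeds its floor [e + m], [x i] is above [c]
    and descends. The margin [e] makes [x i > c] strict at the floor itself. *)
Lemma coord_le_max x i a b c : quantized_solution x -> 0 < a -> a <= b ->
    (forall t v, a <= t <= b -> quantized_velocity x t v -> c < x t i ord0 ->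
      consensus G v i <= 0) ->
  x b i ord0 <= Num.max (x a i ord0) c.
Proof.
move=> xs a0 ab desc; apply/ler_addgt0Pl => e e0.
set m := Num.max _ _; pose g t := Num.max (x t i ord0) (e + m).
have am : x a i ord0 <= m by rewrite le_max lexx.
have cm : c <= m by rewrite le_max lexx orbT.
have ac := quantized_solution_ac _ _ _ xs a0 ab.
have [_ [N N0 xN]] := xs.
have glip s u : `|g s - g u| <= 1 * enorm (x s - x u).
  rewrite mul1r; apply: le_trans (coord_le_enorm _ _ _ i); rewrite !mxE /g.
  have /ler_normlP[] := lexx `|x s i ord0 - x u i ord0|.
  rewrite ler_norml; case: (leP (x s i ord0)) => ?; case: (leP (x u i ord0)) => ?; lra.
have : g b - g a <= 0 * (b - a).
  apply: (ac_increment_le _ _ x _ _ 1 _ g N) => // t tab Nt r r0.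
  have [v xv] := xN t ltac:(lra) Nt.
  have [tm|mt] := ltP (x t i ord0) (e + m).
    have tm0 : 0 < e + m - x t i ord0 by rewrite subr_gt0.
    have [d d0 xd] := ac_uniformly_continuous ac tm0.
    exists d => // u s atu tsb ud sd.
    have := xd t s ltac:(lra) ltac:(lra) ltac:(lra) ltac:(lra).
    have := coord_le_enorm _ _ (x s - x t) i; rewrite !mxE.
    have := ler_norm (x s i ord0 - x t i ord0) => h1 h2 h3.
    have gs : g s = e + m by rewrite /g max_r//; lra.
    have gu : e + m <= g u by rewrite /g le_max lexx orbT.
    have : 0 <= r * (s - u) by rewrite mulr_ge0//; lra.
    by lra.
  have dx := slope_le (xv.2 i) (desc _ _ tab xv ltac:(lra)) r0.
  have [d d0 {}dx] := dx; exists d => // u s atu tsb ud sd.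
  have := dx t s ltac:(lra) ltac:(lra) sd.
  have := dx u t ltac:(lra) ud ltac:(lra).
  have gu : x u i ord0 <= g u by rewrite /g le_max lexx.
  have : 0 <= r * (s - t) by rewrite mulr_ge0//; lra.
  have gu' : e + m <= g u by rewrite /g le_max lexx orbT.
  have : 0 <= r * (t - u) by rewrite mulr_ge0//; lra.
  by rewrite [g s]/g; case: (leP (x s i ord0)) => ?; lra.
rewrite mul0r subr_le0 => gba.
have : x b i ord0 <= g b by rewrite /g le_max lexx.
by move: gba; rewrite {2}/g max_r; lra.
Qed.

Lemma quantized_le v K z i : quantized D z (v i) ->
  z < (K%:~R + 2^-1) * D -> v i <= K%:~R * D.
Proof. by move=> qz; have [_] := qz K. Qed.

Lemma quantized_ge v K z i : quantized D z (v i) ->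
  (K%:~R - 2^-1) * D < z -> K%:~R * D <= v i.
Proof. by move=> qz; have [] := qz K. Qed.

(** Over a short time no agent climbs a whole cell, so all values stay at most [(K + 1) D]. An agent
    above the ceiling has at least that value, hence a maximal one, and cannot climb. *)
Lemma forward_invariant (D0 : 0 < D) x K a b : quantized_solution x -> 0 < a -> a <= b ->
    (forall i, x a i ord0 <= (K%:~R + 2^-1) * D) ->
  forall i, x b i ord0 <= (K%:~R + 2^-1) * D.
Proof.
move=> xs a0 ab xa.
have ac := quantized_solution_ac _ _ _ xs a0 ab.
have [d d0 xd] := ac_uniformly_continuous ac D0.
apply: (segment_induction _ a b
  (fun t => forall i, x t i ord0 <= (K%:~R + 2^-1) * D)) => // t tab.
exists (d / 2); first by rewrite divr_gt0.
move=> u s atu tsb ud sd xu i.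
have := coord_le_max x i u s ((K%:~R + 2^-1) * D) xs ltac:(lra) ltac:(lra).
rewrite max_r//; apply => p v ups [qv _] xp.
have vi : (K + 1)%:~R * D <= v i.
  by apply: quantized_ge (qv i) _; rewrite intrD; lra.
apply: consensus_le0 => j; apply: le_trans vi; apply: quantized_le (qv j) _.
have := xd u p ltac:(lra) ltac:(lra) ltac:(lra) ltac:(lra).
have := coord_le_enorm _ _ (x p - x u) j; rewrite !mxE.
have := ler_norm (x p j ord0 - x u j ord0); have := xu j.
by rewrite intrD; lra.
Qed.

(** Take the least [K] whose ceiling is ever reached from time 1 on; invariance applied to [- x]
    bounds such [K] from below. Times start at 1 since velocities are prescribed only at positive
    times. *)
Lemma eventual_ceiling (D0 : 0 < D) x : (0 < n)%N -> quantized_solution x ->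
  exists K T, [/\ 1 <= T, forall i, x T i ord0 <= (K%:~R + 2^-1) * D &
    forall t, 1 <= t -> exists i, (K%:~R - 2^-1) * D < x t i ord0].
Proof.
move=> n0 xs; pose Q (K : int) := exists2 T, 1 <= T &
  forall i, x T i ord0 <= (K%:~R + 2^-1) * D.
have [L QL] : exists L : int, Q L /\ forall K, Q K -> - L - 1 <= K.
  have [L xL] : exists L : int, forall i, `|x 1 i ord0| <= L%:~R * D.
    exists (Num.ceil (enorm (x 1) / D)) => i.
    by apply: le_trans (coord_le_enorm _ _ _ i) _; rewrite -ler_pdivrMr// ceil_ge.
  exists L; split=> [|K [T T1 xT]].
    by exists 1 => // i; have := xL i; rewrite ler_norml; lra.
  have xL' i : (- x 1) i ord0 <= (L%:~R + 2^-1) * D.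
    by rewrite mxE; have := xL i; rewrite ler_norml; lra.
  have h := forward_invariant D0 (fun t => - x t) L 1 T (quantized_solutionN x xs)
    ltr01 T1 xL' (Ordinal n0).
  have := xT (Ordinal n0); move: h; rewrite mxE => h h'.
  have : (- L - 1)%:~R * D <= K%:~R * D by rewrite intrB mulrNz; lra.
  by rewrite ler_pM2r// ler_int.
have [QL1 Qge] := QL.
(* Candidates are counted from their lower bound [- L - 1], to minimize over naturals. *)
have ex : exists m : nat, `[< Q (- L - 1 + m%:Z) >].
  exists (absz (L - (- L - 1))%R); apply/asboolP; rewrite gez0_abs ?subr_ge0 ?Qge//.
  by rewrite addrC subrK.
case: (ex_minnP ex) => m /asboolP[T T1 xT] mmin.
exists (- L - 1 + m%:Z), T; split => // t t1; apply: contrapT => /forallNP nx.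
have Qm : Q (- L - 1 + m%:Z - 1).
  by exists t => // i; have := nx i; move=> /negP; rewrite -leNgt intrB; lra.
have := Qge _ Qm => mL; have m0 : (0 < m)%N by lia.
have : (m <= m.-1)%N.
  apply: mmin; apply/asboolP; rewrite (_ : _ + _ = - L - 1 + m%:Z - 1)//; lia.
by lia.
Qed.

(* While [x r] sits on the ceiling for ever, [v r >= K D] and there is nothing
   to do. Once it has left it, a component of [v] above [K D] could only be
   carried by agents at rest on the ceiling, hence by all their ancestors,
   including [r]; so all components stay at most [K D] and [x r] never returns. *)
Lemma ceiling_certificate (D0 : 0 < D) x r K T1 : quantized_solution x ->
    (forall j, connect (edge G) r j) -> 1 <= T1 ->
    (forall i, x T1 i ord0 <= (K%:~R + 2^-1) * D) ->
    (forall t, 1 <= t -> exists i, (K%:~R - 2^-1) * D < x t i ord0) ->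
  exists (w : 'I_n -> R) (c T : R), 0 < c /\ forall t v, T < t ->
    quantized_velocity x t v ->
    \sum_k w k * consensus G v k <= - c * (K%:~R * D - v r).
Proof.
move=> xs root T11 xT1 xfloor.
set b := (K%:~R + 2^-1) * D in xT1.
have T10 : 0 < T1 by lra.
have xb t i : T1 <= t -> x t i ord0 <= b.
  by move=> T1t; exact: (forward_invariant D0 _ _ _ _ xs T10 T1t).
have [stay|/existsNP[T2 /not_implyP[T12 /negP xrT2]]] :=
    pselect (forall t, T1 < t -> b <= x t r ord0).
  exists (fun=> 0), 1, T1; split => // t v T1t [qv _].
  rewrite big1 => [|k _]; last by rewrite mul0r.
  have /quantized_ge := qv r => /(_ K).
  have := stay t T1t; rewrite /b; lra.
rewrite -ltNge in xrT2.
have below t v : T1 < t -> quantized_velocity x t v -> x t r ord0 < b ->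
    forall j, v j <= K%:~R * D.
  move=> T1t [qv dv] xr.
  have [j _ vmax] := @Order.TotalTheory.arg_maxP _ _ 'I_n r xpredT v isT.
  have [vj l|vj] := leP (v j) (K%:~R * D); first exact: le_trans (vmax l isT) vj.
  exfalso.
  have vjr : v r = v j.
    apply: (consensus_max_root G v (v j) r j) => // [k|k vk]; first exact: vmax.
    (* A value above [K D] forces [x k] onto the ceiling, which it never exceeds after [T1], so its
       derivative vanishes. *)
    apply: is_derive_max T1t _ (dv k) => s T1s.
    apply: le_trans (xb _ _ (ltW T1s)) _; rewrite leNgt; apply/negP => xk.
    have := quantized_le _ _ _ _ (qv k) xk; rewrite vk; lra.
  by have := quantized_le _ _ _ _ (qv r) xr; rewrite vjr; lra.
have descent t v i : (forall j, v j <= K%:~R * D) -> quantized_velocity x t v ->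
    (K%:~R - 2^-1) * D < x t i ord0 -> consensus G v i <= 0.
  move=> vK [qv _] xi; apply: consensus_le0 => j.
  exact: le_trans (vK j) (quantized_ge _ _ _ _ (qv i) xi).
have xr t : T2 <= t -> x t r ord0 < b.
  move=> T2t; have := coord_le_max x r T2 t ((K%:~R - 2^-1) * D) xs ltac:(lra) T2t.
  move=> /(_ _)/le_lt_trans; apply; last by rewrite gt_max xrT2 /b ltr_pM2r//; lra.
  move=> s v sT2 xv xs'; have [srb|srb] := ltP (x s r ord0) b.
    apply: (descent s) => //; apply: (below s) => //; lra.
  have T1s : T1 < s by lra.
  rewrite (is_derive_max T1s _ (xv.2 r)) ?lexx// => p T1p.
  by apply: le_trans srb; apply: xb; lra.
have {}below t v : T2 <= t -> quantized_velocity x t v -> forall j, v j <= K%:~R * D.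
  by move=> T2t xv; apply: (below t) => //; [lra | exact: xr].
have [i xi] : exists i, forall t, T2 <= t -> (K%:~R - 2^-1) * D < x t i ord0.
  apply: contrapT => /forallNP nx.
  (* Otherwise each agent is at or below [(K - 1/2) D] at some time and stays there by [descent]; at
     the latest of these times no agent is above. *)
  have /choice[tau tauP] i : exists t, T2 <= t /\ x t i ord0 <= (K%:~R - 2^-1) * D.
    have /existsNP[t /not_implyP[? /negP]] := nx i.
    by rewrite -leNgt; exists t.
  pose T := \big[Num.max/T2]_i tau i.
  have tauT i : tau i <= T by exact: le_bigmax.
  have T2T : T2 <= T by exact: bigmax_ge_id.
  have [i] := xfloor T ltac:(lra); have [T2i xti] := tauP i.
  have := coord_le_max x i (tau i) T ((K%:~R - 2^-1) * D) xs ltac:(lra) (tauT i).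
  rewrite max_r// => h; suff : x T i ord0 <= (K%:~R - 2^-1) * D by rewrite leNgt => /negP.
  by apply: h => t v tT xv; apply: (descent t) => //; apply: (below t) => //; lra.
have [w [c [c0 wc]]] := consensus_certificate G r i (root i).
exists w, c, T2; split => // t v T2t xv; apply: wc; first exact: (below t v (ltW T2t) xv).
exact: quantized_ge (xv.1 i) (xi t (ltW T2t)).
Qed.

(** [K'] is the ceiling index of [- x], so the eventual lower bound is [- (K' + 1/2) D]. *)
Lemma ceilings_adjacent (D0 : 0 < D) x r K K' T T' : quantized_solution x ->
    (forall j, connect (edge G) r j) -> 1 <= T -> 1 <= T' ->
    (forall i, x T i ord0 <= (K%:~R + 2^-1) * D) ->
    (forall t, 1 <= t -> exists i, (K%:~R - 2^-1) * D < x t i ord0) ->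
    (forall i, - x T' i ord0 <= (K'%:~R + 2^-1) * D) ->
    (forall t, 1 <= t -> exists i, (K'%:~R - 2^-1) * D < - x t i ord0) ->
  K + K' <= 0.
Proof.
move=> xs root T1 T'1 xT xfloor xT' xfloor'.
rewrite leNgt; apply/negP => KK'.
have KD : D <= (K%:~R + K'%:~R) * D.
  by apply: ler_peMl; [exact: ltW | rewrite -intrD ler1z; lia].
have xsN := quantized_solutionN x xs.
have [w [c [S [c0 wc]]]] := ceiling_certificate D0 x r K T xs root T1 xT xfloor.
have [|t t1|w' [c' [S' [c'0 wc']]]] :=
    ceiling_certificate D0 (fun t => - x t) r K' T' xsN root T'1.
- by move=> i; rewrite mxE.
- by have [i xi] := xfloor' t t1; exists i; rewrite mxE.
pose a := Num.max (Num.max T T') (Num.max S S') + 1.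
have [aT aT' aS aS'] : [/\ T < a, T' < a, S < a & S' < a].
  by rewrite /a !ltr_pwDr// !le_max lexx ?orbT.
(* These weights cancel [v r] between the two certificates and leave the rate
   [- c * c' * (K + K') * D], at most [- m]. *)
pose y k := c' * w k - c * w' k.
pose B := \sum_k `|y k| * ((K%:~R + K'%:~R + 1) * D).
have B0 : 0 <= B by apply: sumr_ge0 => k _; rewrite mulr_ge0//; lra.
pose m := c * c' * D; have m0 : 0 < m by rewrite !mulr_gt0.
(* By time [e] the combination [g] would drop by [B + 1], while its oscillation after [a] is at most
   [B]. *)
pose e := a + (B + 1) / m.
have ae : a <= e by rewrite /e lerDl divr_ge0// ltW//; lra.
pose g t := \sum_k y k * x t k ord0.
have gsub s u : g s - g u = \sum_k y k * (x s k ord0 - x u k ord0).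
  by rewrite /g -sumrB; apply: eq_bigr => k _; rewrite mulrBr.
have [_ [N N0 xN]] := xs.
have : g e - g a <= - m * (e - a).
  apply: (ac_increment_le _ _ x _ _ (\sum_k `|y k|) _ g N) => //.
  - exact: sumr_ge0.
  - by apply: quantized_solution_ac => //; lra.
  - move=> s u; rewrite gsub mulr_suml; apply: le_trans (ler_norm_sum _ _ _) _.
    apply: ler_sum => k _; rewrite normrM ler_wpM2l//.
    by apply: le_trans (coord_le_enorm _ _ _ k); rewrite !mxE.
  move=> t tae Nt h h0; have [v xv] := xN t ltac:(lra) Nt.
  have dg : is_derive t 1 g (\sum_k y k * consensus G v k).
    rewrite /g (_ : (fun _ => _) = \sum_k (fun s => y k * x s k ord0)); last first.
      by apply/funext => s; rewrite fct_sumE.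
    by apply: is_derive_sum => k; apply: is_deriveZ; exact: xv.2.
  have gm : \sum_k y k * consensus G v k <= - m.
    have -> : \sum_k y k * consensus G v k = c' * (\sum_k w k * consensus G v k) +
        c * (\sum_k w' k * consensus G (fun i => - v i) k).
      rewrite !mulr_sumr -big_split/=; apply: eq_bigr => k _.
      by rewrite consensusN /y; ring.
    have := ler_wpM2l (ltW c'0) (wc t v ltac:(lra) xv).
    have := ler_wpM2l (ltW c0) (wc' t _ ltac:(lra) (quantized_velocityN x t v xv)).
    have := ler_wpM2l (ltW (mulr_gt0 c0 c'0)) KD.
    by rewrite /m; lra.
  have [d d0 gd] := slope_le dg gm h0.
  by exists d => // u s atu tse; apply: gd; lra.
have xbound s k : a <= s -> - ((K'%:~R + 2^-1) * D) <= x s k ord0 <= (K%:~R + 2^-1) * D.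
  move=> a_s; rewrite (forward_invariant D0 x K T s xs) ?andbT//; [|lra|lra].
  rewrite lerNl; have := forward_invariant D0 _ K' T' s xsN ltac:(lra) ltac:(lra).
  by move=> /(_ _ k); rewrite mxE; apply => i; rewrite mxE.
have : - B <= g e - g a.
  rewrite gsub /B -sumrN; apply: ler_sum => k _.
  rewrite lerNl; apply: le_trans (ler_norm _) _; rewrite normrN normrM ler_wpM2l//.
  by have := xbound e k ae; have := xbound a k (lexx a); rewrite ler_norml; lra.
have -> : - m * (e - a) = - (B + 1) by rewrite /e addrAC subrr add0r; field; rewrite gt_eqF.
by lra.
Qed.

End quantized_solutions.

Theorem corollaryV1 (R : realType) (n : nat) (G : weighted_digraph R n)
    (Gtree : has_spanning_tree G) (Delta : R) (Delta_gt0 : 0 < Delta)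
    (x : R -> 'cV[R]_n)
    (xsol : filippov_solution
              (fun y => - laplacian G *m quantizer_vec Delta y) x) :
  dist_to_set (D2 Delta) (x t) @[t --> +oo] --> (0 : R).
Proof.
have [r root] := Gtree; have n0 : (0 < n)%N := leq_ltn_trans (leq0n r) (ltn_ord r).
have xs := filippov_quantized_solution G Delta Delta_gt0 x n0 xsol.
have xsN := quantized_solutionN G Delta x xs.
have [K [T [T1 xT xfloor]]] := eventual_ceiling G Delta Delta_gt0 x n0 xs.
have [K' [T' [T'1 xT' xfloor']]] := eventual_ceiling G Delta Delta_gt0 _ n0 xsN.
have KK' : K + K' <= 0.
  apply: (ceilings_adjacent G Delta Delta_gt0 x r K K' T T') => // [i|t t1].
  - by have := xT' i; rewrite mxE.
  - by have [i] := xfloor' t t1; rewrite mxE; exists i.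
have xD t : T <= t -> T' <= t -> D2 Delta (x t).
  move=> Tt T't; exists K => i.
  have := forward_invariant G Delta Delta_gt0 x K T t xs ltac:(lra) Tt xT i.
  have := forward_invariant G Delta Delta_gt0 _ K' T' t xsN ltac:(lra) T't xT' i.
  have : (K%:~R + K'%:~R) * Delta <= 0.
    by rewrite pmulr_lle0// -intrD lerz0.
  by rewrite mxE => h1 h2 h3; apply/andP; split; lra.
(* The set is reached in finite time, so the distance is eventually exactly 0. *)
apply: cvg_near_cst; near=> t.
have Dt : D2 Delta (x t) by apply: xD; near: t; apply: nbhs_pinfty_ge; exact: num_real.
have lb0 : lbound [set enorm (x t - y) | y in D2 Delta] 0.
  by move=> _ [y _ <-]; exact: enorm_ge0.
apply/eqP; rewrite eq_le lb_le_inf//; last by exists (enorm (x t - x t)), (x t).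
rewrite andbT; apply: ge_inf; first by exists 0.
exists (x t) => //; rewrite subrr /enorm big1 ?sqrtr0// => i _.
by rewrite mxE expr0n.
Unshelve. all: by end_near. Qed.
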